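(* Let $\mathcal{H}$ and $\mathcal{G}$ be real Hilbert spaces, let $L\in\mathcal{B}(\mathcal{H},\mathcal{G})$ satisfy $0<\|L\|\leq 1$, let $B\in\mathcal{S}(\mathcal{G})$, and let $\gamma\in\,]0,+\infty[$. Then the following hold: (i) Set $\theta=1/(1+\gamma\|B\|)$. Then $\theta(L^*\circ B\circ L)\preccurlyeq L\overset{\gamma}{\bullet}B\preccurlyeq L^*\circ B\circ L$. (ii) Suppose that $A\in\mathcal{S}(\mathcal{G})$ satisfies $A\preccurlyeq B$. Then $L\overset{\gamma}{\bullet}A\preccurlyeq L\overset{\gamma}{\bullet}B$. (iii) Let $\rho\in\,]0,+\infty[$ be such that $\rho\leq\gamma$. Then $L\overset{\gamma}{\bullet}B\preccurlyeq L\overset{\rho}{\bullet}B$.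
   Context: $\mathcal{B}(\mathcal{H},\mathcal{G})$ is the space of bounded linear operators from $\mathcal{H}$ to $\mathcal{G}$ with the operator norm, $\mathcal{B}(\mathcal{H})=\mathcal{B}(\mathcal{H},\mathcal{H})$, and $L^*$ is the adjoint of $L$. $\mathcal{P}(\mathcal{H})$ is the set of self-adjoint $A\in\mathcal{B}(\mathcal{H})$ with $\langle Ax,x\rangle\geq 0$ for all $x\in\mathcal{H}$. For self-adjoint $A,B$, $A\preccurlyeq B$ means $B-A\in\mathcal{P}(\mathcal{H})$. $\mathcal{S}(\mathcal{H})$ is the set of $A\in\mathcal{P}(\mathcal{H})$ for which there exists $\alpha>0$ with $\alpha\,\mathrm{Id}_{\mathcal{H}}\preccurlyeq A$. For a set-valued operator $M\colon\mathcal{G}\to 2^{\mathcal{G}}$, $M^{-1}$ is the set-valued inverse ($x\in M^{-1}y\Leftrightarrow y\in Mx$); sums and compositions are taken in the set-valued sense, e.g. $(L^*\circ M\circ L)x=\{L^*y : y\in M(Lx)\}$; a set-valued operator all of whose values are singletons is identified with the corresponding single-valued operator. The parallel composition of $M$ by $L^*$ is $L^*\triangleright M=(L^*\circ M^{-1}\circ L)^{-1}$. For $\gamma\in\,]0,+\infty[$, the resolvent composition is $L\overset{\gamma}{\diamond}M=L^*\triangleright(M+\gamma^{-1}\mathrm{Id}_{\mathcal{G}})-\gamma^{-1}\mathrm{Id}_{\mathcal{H}}$, and the resolvent cocomposition is $L\overset{\gamma}{\bullet}M=\bigl(L\overset{1/\gamma}{\diamond}M^{-1}\bigr)^{-1}$.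 *)

(* Defs.v *)
From HB Require Import structures.
From mathcomp Require Import all_boot all_order all_algebra sesquilinear.
From mathcomp Require Import all_classical all_reals all_analysis.

Set Implicit Arguments.
Unset Strict Implicit.
Unset Printing Implicit Defensive.

Import Order.TTheory GRing.Theory Num.Theory.
Import numFieldNormedType.Exports.

Local Open Scope classical_set_scope.
Local Open Scope ring_scope.

HB.mixin Record isHilbert (R : realType) (H : Type)
    & CompleteNormedModule R H := {
  inner : {dot H for (idfun : R -> R)};
  norm_inner : forall x : H, `|x| = Num.sqrt (inner x x)
}.

#[short(type="hilbertType")]
HB.structure Definition Hilbert (R : realType) :=
  {H of CompleteNormedModule R H & isHilbert R H}.

Section Operators.
Context {R : realType}.
Implicit Types H G K : hilbertType R.

Definition bounded_operator {H G} (T : H -> G) : Prop :=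
  linear T /\ exists M : R, forall x, `|T x| <= M * `|x|.

Definition opnorm {H G} (T : H -> G) : R :=
  sup [set `|T x| | x in [set x : H | `|x| <= 1]].

(* For a bounded operator, the Riesz theorem provides exactly one such [z];
   the default value [0] is only relevant for functions that are not bounded
   operators. *)
Definition adjoint {H G} (T : H -> G) : G -> H :=
  fun y => xget 0 [set z : H | forall x : H, inner (T x) y = inner x z].

Definition selfadjoint {H} (A : H -> H) : Prop :=
  bounded_operator A /\ adjoint A = A.

(* The class P(H). *)
Definition positive_operator {H} (A : H -> H) : Prop :=
  selfadjoint A /\ forall x, 0 <= inner (A x) x.

Definition loewner_le {H} (A B : H -> H) : Prop :=
  [/\ selfadjoint A, selfadjoint B & positive_operator (B \- A)].

(* The class S(H). *)
Definition strongly_positive_operator {H} (A : H -> H) : Prop :=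
  positive_operator A /\
  exists2 alpha : R, 0 < alpha & loewner_le (alpha \*: (@idfun H)) A.

(* A set-valued operator M : H -> 2^G is a function [H -> set G]; [single f] is
   the set-valued operator identified with the function [f]. *)
Definition single {H G} (f : H -> G) : H -> set G := fun x => [set f x].

Definition sv_inv {H G} (M : H -> set G) : G -> set H :=
  fun y => [set x | M x y].

Definition sv_add {H G} (M N : H -> set G) : H -> set G :=
  fun x => [set u + v | u in M x & v in N x].

Definition sv_comp {H G K} (N : G -> set K) (M : H -> set G) : H -> set K :=
  fun x => \bigcup_(y in M x) N y.

(* [parallel_comp L M] is the parallel composition of M by the adjoint of L. *)
Definition parallel_comp {H G} (L : H -> G) (M : G -> set G) : H -> set H :=
  sv_inv (sv_comp (single (adjoint L)) (sv_comp (sv_inv M) (single L))).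

Definition resolvent_comp {H G} (gamma : R) (L : H -> G) (M : G -> set G) :
    H -> set H :=
  sv_add (parallel_comp L (sv_add M (single (gamma^-1 \*: (@idfun G)))))
         (single (- gamma^-1 \*: (@idfun H))).

Definition resolvent_cocomp {H G} (gamma : R) (L : H -> G) (M : G -> set G) :
    H -> set H :=
  sv_inv (resolvent_comp gamma^-1 L (sv_inv M)).

(* The Loewner order on set-valued operators, under the identification of
   operators having only singleton values with functions. It includes the
   assertion that both sides are everywhere defined, single-valued, linear,
   bounded and self-adjoint. *)
Definition sv_loewner_le {H} (M N : H -> set H) : Prop :=
  exists S T : H -> H, [/\ M = single S, N = single T & loewner_le S T].

End Operators.

(* Main.v *)
(* The cocomposition of [B] with parameter [gamma] is
   [L^* o (B^-1 + gamma (1 - L o L^* ))^-1 o L], where [1 - L o L^*] lies between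
   [0] and [1] because [|L| <= 1]. Each assertion thus reduces to a comparison of
   operators [B^-1 + gamma (1 - L o L^* )], since inversion is antitone on
   strongly positive operators: (ii) and (iii) are immediate, the upper bound in
   (i) drops the defect term, and the lower bound uses
   [1 - L o L^* <= 1 <= |B| B^-1]. *)
Require Import Defs.
From mathcomp Require Import all_boot all_order all_algebra sesquilinear.
From mathcomp Require Import all_classical all_reals all_analysis.
From mathcomp Require Import ring lra.

Set Implicit Arguments.
Unset Strict Implicit.
Unset Printing Implicit Defensive.

Import Order.TTheory GRing.Theory Num.Theory.
Import numFieldNormedType.Exports.

Local Open Scope classical_set_scope.
Local Open Scope ring_scope.

(** * Bilinearity of the inner product and the Cauchy-Schwarz inequality *)

Section InnerProduct.
Context {R : realType} {H : hilbertType R}.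
Implicit Types (x y z : H) (a : R).

Lemma innerDl x y z : inner (x + y) z = inner x z + inner y z.
Proof. by rewrite linearDl. Qed.

Lemma innerBl x y z : inner (x - y) z = inner x z - inner y z.
Proof. by rewrite linearBl. Qed.

Lemma innerZl a x y : inner (a *: x) y = a * inner x y.
Proof. by rewrite linearZl_LR. Qed.

Lemma innerC x y : inner x y = inner y x.
Proof. by rewrite hermC expr0 mul1r. Qed.

Lemma innerDr x y z : inner x (y + z) = inner x y + inner x z.
Proof. by rewrite linearD. Qed.

Lemma innerBr x y z : inner x (y - z) = inner x y - inner x z.
Proof. by rewrite linearB. Qed.

Lemma innerZr a x y : inner x (a *: y) = a * inner x y.
Proof. by rewrite innerC innerZl innerC. Qed.

Lemma inner0l x : inner 0 x = 0.
Proof. by rewrite linear0l. Qed.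

Lemma inner_ge0 x : 0 <= inner x x.
Proof.
have [->|/(neq0_dnorm_gt0 (s := inner))/ltW//] := eqVneq x 0.
by rewrite inner0l.
Qed.

Lemma inner_norm x : inner x x = `|x| ^+ 2.
Proof. by rewrite norm_inner sqr_sqrtr// inner_ge0. Qed.

Lemma inner_injl x y : (forall z, inner x z = inner y z) -> x = y.
Proof.
move=> xy; apply/eqP; rewrite -subr_eq0 -normr_eq0 -sqrf_eq0 -inner_norm.
by rewrite innerBl xy subrr.
Qed.

Lemma cauchy_schwarz x y : `|inner x y| <= `|x| * `|y|.
Proof.
rewrite -(@ler_pXn2r _ 2)// ?nnegrE ?mulr_ge0// real_normK ?num_real//.
rewrite exprMn -!inner_norm.
have [->|y0] := eqVneq y 0; first by rewrite innerC !inner0l mulr0 expr0n.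
have yy0 : 0 < inner y y by exact: (neq0_dnorm_gt0 (s := inner)).
(* The square norm of this vector is [inner y y] times the gap in the squared inequality. *)
have := inner_ge0 (inner y y *: x - inner x y *: y).
rewrite !(innerBl, innerBr, innerZl, innerZr) (innerC y x) => h.
rewrite -subr_ge0 -(pmulr_rge0 _ yy0); apply: le_trans h _.
by rewrite le_eqVlt; apply/orP; left; apply/eqP; ring.
Qed.
End InnerProduct.

(** * Bounded operators, the operator norm and the Lax-Milgram theorem *)

Section BoundedOperators.
Context {R : realType}.
Implicit Types H G K : hilbertType R.

Lemma linearPD {U V : lmodType R} (f : U -> V) : linear f ->
  forall x y, f (x + y) = f x + f y.
Proof. by move=> lf x y; have := lf 1 x y; rewrite !scale1r. Qed.

Lemma linearPB {U V : lmodType R} (f : U -> V) : linear f ->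
  forall x y, f (x - y) = f x - f y.
Proof. exact: GRing.zmod_morphism_linear. Qed.

Lemma linearPZ {U V : lmodType R} (f : U -> V) : linear f ->
  forall a x, f (a *: x) = a *: f x.
Proof. exact: GRing.scalable_linear. Qed.

(** A strictly positive bound can be divided by in later estimates. *)
Lemma bounded_operatorP H G (T : H -> G) : bounded_operator T ->
  exists2 M, 0 < M & forall x, `|T x| <= M * `|x|.
Proof.
move=> [_ [M TM]]; exists (`|M| + 1); first by rewrite ltr_wpDl.
move=> x; apply: le_trans (TM x) _; rewrite ler_wpM2r//.
by rewrite (le_trans (ler_norm M))// lerDl.
Qed.

Lemma opnorm_ubound H G (T : H -> G) : bounded_operator T ->
  has_ubound [set `|T x| | x in [set x : H | `|x| <= 1]].
Proof.
move=> /bounded_operatorP[M M0 TM]; exists M => _ [x/= x1 <-].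
by rewrite (le_trans (TM x))// ler_piMr// ltW.
Qed.

Lemma opnorm_ge0 H G (T : H -> G) : bounded_operator T -> 0 <= opnorm T.
Proof.
move=> bT; apply: (@le_trans _ _ `|T 0|) => //.
by apply: ub_le_sup; [exact: opnorm_ubound|exists 0; rewrite //= normr0].
Qed.

Lemma opnorm_le H G (T : H -> G) : bounded_operator T ->
  forall x, `|T x| <= opnorm T * `|x|.
Proof.
move=> bT x; have [lT _] := bT.
have [->|x0] := eqVneq x 0.
  by rewrite -[X in T X](scale0r 0) (linearPZ lT) scale0r !normr0 mulr0.
have nx : 0 < `|x| by rewrite normr_gt0.
(* Rescaling [x] to a unit vector puts it in the set whose supremum is [opnorm T]. *)
rewrite -ler_pdivrMr// mulrC -[`|x|^-1]gtr0_norm ?invr_gt0//.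
rewrite -normrZ -(linearPZ lT); apply: ub_le_sup; first exact: opnorm_ubound.
exists (`|x|^-1 *: x) => //=.
by rewrite normrZ gtr0_norm ?invr_gt0// mulVf ?gt_eqF.
Qed.

Lemma bounded_operator_id H : bounded_operator (@idfun H).
Proof. by split=> //; exists 1 => x; rewrite mul1r. Qed.

Lemma bounded_operator_comp H G K (S : G -> K) (T : H -> G) :
  bounded_operator S -> bounded_operator T -> bounded_operator (S \o T).
Proof.
move=> bS bT; have [N N0 SN] := bounded_operatorP bS.
have [M M0 TM] := bounded_operatorP bT; split.
  by move=> a x y /=; rewrite bT.1 bS.1.
exists (N * M) => x /=; apply: le_trans (SN _) _.
by rewrite -mulrA ler_pM2l.
Qed.

Lemma bounded_operatorD H G (S T : H -> G) :
  bounded_operator S -> bounded_operator T -> bounded_operator (S \+ T).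
Proof.
move=> [lS [N SN]] [lT [M TM]]; split.
  by move=> a x y /=; rewrite lS lT scalerDr addrACA.
exists (N + M) => x /=; apply: le_trans (ler_normD _ _) _.
by rewrite mulrDl lerD.
Qed.

Lemma bounded_operatorZ H G (a : R) (T : H -> G) :
  bounded_operator T -> bounded_operator (a \*: T).
Proof.
move=> [lT [M TM]]; split.
  by move=> b x y /=; rewrite lT scalerDr !scalerA mulrC.
exists (`|a| * M) => x /=; rewrite normrZ -mulrA.
by rewrite ler_wpM2l.
Qed.

Lemma bounded_operatorB H G (S T : H -> G) :
  bounded_operator S -> bounded_operator T -> bounded_operator (S \- T).
Proof.
move=> bS bT; rewrite (_ : S \- T = S \+ (-1 \*: T)); last first.
  by apply/funext => x /=; rewrite scaleN1r.
exact/bounded_operatorD/bounded_operatorZ.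
Qed.

(* The solution is the minimiser of [q x = <A x, x> - 2 f x]: coercivity makes
   every minimising sequence Cauchy, and the Euler-Lagrange equation passes to
   the limit. *)
Lemma lax_milgram H (A : H -> H) (f : H -> R) (alpha K : R) :
  bounded_operator A -> (forall x y, inner (A x) y = inner x (A y)) ->
  0 < alpha -> (forall x, alpha * inner x x <= inner (A x) x) ->
  scalar f -> (forall x, `|f x| <= K * `|x|) ->
  exists x, forall y, inner (A x) y = f y.
Proof.
move=> bA sA alpha0 cA sf fK; have [lA _] := bA.
have [M M0 AM] := bounded_operatorP bA.
pose q x := inner (A x) x - 2 * f x.
(* Exact expansion of [q] along a line; the coefficient of [t] is twice the Euler-Lagrange
   residual. *)
have qD x y t : q (x + t *: y) =
    q x + 2 * t * (inner (A x) y - f y) + t ^+ 2 * inner (A y) y.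
  rewrite /q (addrC x) lA sf !(innerDl, innerDr, innerZl, innerZr) (sA y x).
  by rewrite (innerC y); ring.
have q_lb : has_lbound (range q).
  (* Minimum over real [s] of [alpha * s ^+ 2 - 2 * K * s], which bounds [q x] from below at
     [s = |x|]. *)
  exists (- (K ^+ 2) / alpha) => _ [x _ <-]; rewrite ler_pdivrMr//.
  have := cA x; have := le_trans (ler_norm _) (fK x).
  rewrite inner_norm /q => fx qx.
  have := ler_wpM2l (ltW alpha0) fx; have := ler_wpM2l (ltW alpha0) qx.
  have := sqr_ge0 (alpha * `|x| - K).
  by lra.
pose m := inf (range q).
have mq x : m <= q x by apply: ge_inf => //; exists x.
have /choice[u um] (n : nat) : exists x, q x < m + n.+1%:R^-1.
  have [||_ [x _ <-] qx] := @inf_adherent _ (range q) n.+1%:R^-1.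
  - by rewrite invr_gt0.
  - by split=> //; exists (q 0); exists 0.
  - by exists x.
(* At the midpoint, [q] equals the mean of its two end values minus a quarter of the form of [A] at
   the difference, and it is still at least [m]. *)
have udist n k : alpha * `|u n - u k| ^+ 2 <= 2 * (n.+1%:R^-1 + k.+1%:R^-1).
  have := mq (u k + 2^-1 *: (u n - u k)).
  have := qD (u k) (u n - u k) 1; rewrite scale1r addrC subrK => e1.
  have := um n; have := um k; have := cA (u n - u k).
  rewrite qD inner_norm; move: n.+1%:R^-1 k.+1%:R^-1 e1 => a b.
  set c := inner _ _ - _; set p := inner _ _; rewrite -/p.
  by move: (q _) (q _) (`|_| ^+ 2) c p => ? ? ? ? ?; lra.
have ucvg : cvg (u @ \oo).
  apply: cauchy_cvg; apply: cauchy_exP => e e0.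
  have d0 : 0 < alpha * e ^+ 2 / 4 by rewrite divr_gt0// mulr_gt0// exprn_gt0.
  have [N _ uN] := near_infty_natSinv_lt (PosNum d0).
  exists (u N); exists N => // n /= /uN /= un; rewrite -ball_normE /ball_ /=.
  rewrite -(@ltr_pXn2r _ 2)// ?nnegrE ?normr_ge0 ?(ltW e0)// -(ltr_pM2l alpha0).
  have /= := uN N (leqnn N); have := udist N n; move: un.
  by move: n.+1%:R^-1 N.+1%:R^-1 => a b; lra.
have ul := cvgr_dist_lt u (lim (u @ \oo)) ucvg; set l := lim _ in ul.
exists l => y; apply/eqP; rewrite -subr_eq0; apply: contraT => d0.
set d := _ - _ in d0; have {}d0 : 0 < `|d| by rewrite normr_gt0.
(* Adding 1 keeps the divisor positive even when [y = 0]. *)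
pose b := inner (A y) y + 1.
have b0 : 0 < b.
  by rewrite ltr_wpDl// (le_trans _ (cA y))// mulr_ge0 ?inner_ge0// ltW.
(* Moving from [u n] by [- dn / b] along [y] lowers [q] by at least [dn ^+ 2 / b], but [q (u n)] is
   within [n.+1%:R^-1] of the infimum. *)
have udn n : (inner (A (u n)) y - f y) ^+ 2 <= b * n.+1%:R^-1.
  pose dn := inner (A (u n)) y - f y; rewrite -/dn.
  have := mq (u n + (- dn / b) *: y); rewrite qD -/dn => mqn.
  have /ltW uq := um n.
  have {uq mqn}h := le_trans mqn (lerD (lerD uq (lexx _)) (lexx _)).
  have := mulr_ge0 (ltW b0) (sqr_ge0 (dn / b)).
  have e1 : b * (dn / b) = dn by rewrite mulrC divfK// gt_eqF.
  rewrite mulNr in h; set t := dn / b in h e1 *.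
  rewrite -e1 exprMn => _; rewrite {1}expr2 -mulrA ler_pM2l//.
  rewrite -e1 (_ : inner (A y) y = b - 1) in h; last by rewrite /b addrK.
  have aux (v c s k : R) :
      v <= v + s + 2 * - c * (k * c) + (- c) ^+ 2 * (k - 1) -> c * (k * c) <= s.
    by have := sqr_ge0 c; lra.
  exact: aux h.
have y0 : 0 < `|y| + 1 by rewrite ltr_wpDl.
(* The first threshold will force [|dn| > |d| / 2] and the second [|dn| < |d| / 2], a
   contradiction. *)
have e0 : 0 < `|d| / (2 * M * (`|y| + 1)) by rewrite divr_gt0// !mulr_gt0.
have e1 : 0 < `|d| ^+ 2 / (4 * b) by rewrite divr_gt0// ?exprn_gt0// mulr_gt0.
near \oo => n.
have : `|l - u n| < `|d| / (2 * M * (`|y| + 1)) by near: n; exact: ul.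
have : n.+1%:R^-1 < `|d| ^+ 2 / (4 * b).
  by near: n; exact: (near_infty_natSinv_lt (PosNum e1)).
rewrite !ltr_pdivlMr ?mulr_gt0// => bn lun.
have := udn n; set dn := _ - _ => dnb.
have ddn : `|d| <= `|dn| + M * `|l - u n| * `|y|.
  have -> : d = dn + inner (A (l - u n)) y.
    by rewrite /d /dn (linearPB lA) innerBl; ring.
  rewrite (le_trans (ler_normD _ _))// lerD2l (le_trans (cauchy_schwarz _ _))//.
  by rewrite ler_wpM2r.
have dn2 : `|dn| ^+ 2 <= b * n.+1%:R^-1 by rewrite real_normK ?num_real.
have hy : M * `|l - u n| * `|y| <= M * `|l - u n| * (`|y| + 1).
  by rewrite ler_wpM2l ?lerDl// mulr_ge0// ltW.
have : `|d| / 2 < `|dn| by lra.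
rewrite -(@ltr_pXn2r _ 2)// ?nnegrE ?normr_ge0 ?divr_ge0// expr_div_n.
by move: n.+1%:R^-1 bn dn2 => s bn dn2; lra.
Unshelve. all: by end_near.
Qed.

End BoundedOperators.

(** * Adjoints, the Loewner order and inverses of strongly positive operators *)

Section Adjoint.
Context {R : realType}.
Implicit Types H G : hilbertType R.

(** Riesz representation is [lax_milgram] for the identity with constant 1, so [xget] finds a
    genuine representative. *)
Lemma adjointP H G (T : H -> G) : bounded_operator T ->
  forall x y, inner (T x) y = inner x (adjoint T y).
Proof.
move=> bT x y; have [M M0 TM] := bounded_operatorP bT.
suff /xgetPex : exists z, forall x, inner (T x) y = inner x z by exact.
have [//|||||z zP] := @lax_milgram _ H idfun (fun x => inner (T x) y) 1
  (M * `|y|) (bounded_operator_id H).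
- exact: ltr01.
- by move=> z; rewrite mul1r.
- by move=> a u v /=; rewrite bT.1 innerDl innerZl.
- move=> z; apply: le_trans (cauchy_schwarz _ _) _.
  by rewrite mulrAC ler_wpM2r.
- by exists z => u; rewrite -zP innerC.
Qed.

Lemma adjoint_eq H G (T : H -> G) (S : G -> H) : bounded_operator T ->
  (forall x y, inner (T x) y = inner x (S y)) -> adjoint T = S.
Proof.
move=> bT TS; apply/funext => y; apply: inner_injl => x.
by rewrite innerC -adjointP// TS innerC.
Qed.

Lemma bounded_operator_adjoint H G (T : H -> G) : bounded_operator T ->
  bounded_operator (adjoint T).
Proof.
move=> bT; have [M M0 TM] := bounded_operatorP bT; split.
  move=> a u v; apply: inner_injl => x.
  rewrite innerC -adjointP// innerDl innerZl ![inner (adjoint _ _) _]innerC.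
  by rewrite -!adjointP// innerDr innerZr.
exists M => y; set z := adjoint T y.
have [->|z0] := eqVneq z 0; first by rewrite normr0 mulr_ge0// ltW.
have nz : 0 < `|z| by rewrite normr_gt0.
rewrite -(ler_pM2l nz) -expr2 -inner_norm -adjointP//.
rewrite (le_trans (ler_norm _))// (le_trans (cauchy_schwarz _ _))//.
by rewrite mulrCA mulrA ler_wpM2r.
Qed.

Lemma selfadjointP H (A : H -> H) : selfadjoint A <->
  bounded_operator A /\ forall x y, inner (A x) y = inner x (A y).
Proof.
split=> [[bA AA]|[bA sA]]; split=> //; last exact: adjoint_eq.
by move=> x y; rewrite adjointP// AA.
Qed.

(** A difference of self-adjoint operators is self-adjoint, so only the comparison of quadratic
    forms remains. *)
Lemma loewner_leP H (A B : H -> H) : loewner_le A B <->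
  [/\ selfadjoint A, selfadjoint B & forall x, inner (A x) x <= inner (B x) x].
Proof.
split=> [[sA sB [_ AB]]|[sA sB AB]]; split=> //.
  by move=> x; have := AB x; rewrite innerBl subr_ge0.
move/selfadjointP: sA => [bA sA]; move/selfadjointP: sB => [bB sB].
split; last by move=> x; rewrite innerBl subr_ge0.
apply/selfadjointP; split; first exact: bounded_operatorB.
by move=> x y /=; rewrite innerBl innerBr sA sB.
Qed.

Lemma strongly_positiveP H (A : H -> H) : strongly_positive_operator A <->
  selfadjoint A /\ exists2 alpha, 0 < alpha &
    forall x, alpha * inner x x <= inner (A x) x.
Proof.
split=> [[[sA _] [a a0 /loewner_leP[_ _ aA]]]|[sA [a a0 aA]]].
  by split=> //; exists a => // x; rewrite -innerZl; exact: aA.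
split; first split=> // x.
  by rewrite (le_trans _ (aA x))// mulr_ge0 ?inner_ge0// ltW.
exists a => //; apply/loewner_leP; split=> //; last first.
  by move=> x /=; rewrite innerZl.
apply/selfadjointP; split.
  exact/bounded_operatorZ/bounded_operator_id.
by move=> x y /=; rewrite innerZl innerZr.
Qed.

(** Lax-Milgram applied to [inner z] gives surjectivity, and coercivity gives injectivity. *)
Lemma strongly_positive_inverse H (A : H -> H) : strongly_positive_operator A ->
  exists A', [/\ strongly_positive_operator A', cancel A A' & cancel A' A].
Proof.
move=> /strongly_positiveP[/selfadjointP[bA sA] [a a0 aA]].
have [M M0 AM] := bounded_operatorP bA.
have /choice[A' A'K] (z : H) : exists x, A x = z.
  have [||x xz] := lax_milgram (f := inner z) (K := `|z|) bA sA a0 aA.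
  - by move=> c u v /=; rewrite innerDr innerZr.
  - exact: cauchy_schwarz.
  - by exists x; exact: inner_injl.
have injA : injective A.
  move=> x y Axy; apply/eqP; rewrite -subr_eq0 -normr_eq0 -sqrf_eq0 -inner_norm.
  have := aA (x - y); rewrite (linearPB bA.1) Axy subrr inner0l pmulr_rle0//.
  by rewrite eq_le inner_ge0 andbT.
have AK : cancel A A' by move=> x; apply: injA; rewrite A'K.
(* The constant comes from [|x| = |A (A' x)| <= M * |A' x|]. *)
have A'_coercive x : a / M ^+ 2 * inner x x <= inner (A' x) x.
  have := aA (A' x); rewrite A'K [inner x _]innerC; apply: le_trans.
  rewrite mulrAC ler_pdivrMr ?exprn_gt0// -mulrA ler_pM2l// mulrC !inner_norm.
  rewrite -exprMn ler_pXn2r ?nnegrE ?mulr_ge0 ?(ltW M0)//.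
  by rewrite -{1}(A'K x).
exists A'; split=> //; apply/strongly_positiveP; split; last first.
  by exists (a / M ^+ 2) => //; rewrite divr_gt0// exprn_gt0.
apply/selfadjointP; split; last by move=> x y; rewrite -{1}(A'K y) -sA A'K.
split.
  by move=> c x y; apply: injA; rewrite bA.1 !A'K.
(* Coercivity at [A' x] and Cauchy-Schwarz give [a * |A' x| ^+ 2 <= |x| * |A' x|]. *)
exists (a^-1) => x; have [->|z0] := eqVneq (A' x) 0.
  by rewrite normr0 mulr_ge0// invr_ge0 ltW.
have nz : 0 < `|A' x| by rewrite normr_gt0.
rewrite mulrC ler_pdivlMr// mulrC -(ler_pM2r nz) -mulrA -expr2 -inner_norm.
rewrite (le_trans (aA _))// A'K.
by rewrite (le_trans (ler_norm _))// cauchy_schwarz.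
Qed.

(* Expand [0 <= <A (A' x - B' x), A' x - B' x>]. *)
Lemma inverse_antitone H (A B A' B' : H -> H) :
  positive_operator A -> cancel A' A -> cancel B' B ->
  (forall x, inner (A x) x <= inner (B x) x) ->
  forall x, inner (B' x) x <= inner (A' x) x.
Proof.
move=> [/selfadjointP[bA sA] A0] A'K B'K AB x.
have := A0 (A' x - B' x); have := AB (B' x).
rewrite (linearPB bA.1) !(innerBl, innerBr) (sA (B' x) (A' x)) A'K B'K.
by rewrite !(innerC x); lra.
Qed.

End Adjoint.

(** * The defect of a contraction and a closed form of the cocomposition *)

Section Cocomposition.
Context {R : realType} {H G : hilbertType R}.
Implicit Types (L : H -> G) (B : G -> G).

Lemma selfadjoint_sandwich L B : bounded_operator L -> selfadjoint B ->
  selfadjoint (adjoint L \o B \o L).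
Proof.
move=> bL /selfadjointP[bB sB]; apply/selfadjointP; split.
  apply: bounded_operator_comp => //; apply: bounded_operator_comp => //.
  exact: bounded_operator_adjoint.
by move=> x y /=; rewrite -adjointP// innerC -adjointP// innerC sB.
Qed.

(** The quadratic form of the sandwich at [x] is that of the middle operator at [L x]. *)
Lemma loewner_le_sandwich L B C : bounded_operator L -> loewner_le B C ->
  loewner_le (adjoint L \o B \o L) (adjoint L \o C \o L).
Proof.
move=> bL /loewner_leP[sB sC BC]; apply/loewner_leP.
split; [exact: selfadjoint_sandwich..|] => x /=.
by rewrite innerC [leRHS]innerC -!adjointP// innerC [leRHS]innerC.
Qed.

(** This operator vanishes exactly when [L] is a coisometry. *)
Definition defect L : G -> G := fun u => u - L (adjoint L u).

Lemma selfadjoint_defect L : bounded_operator L -> selfadjoint (defect L).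
Proof.
move=> bL; apply/selfadjointP; split.
  apply: (@bounded_operatorB _ _ _ idfun (L \o adjoint L)).
    exact: bounded_operator_id.
  by apply: bounded_operator_comp => //; exact: bounded_operator_adjoint.
move=> x y; rewrite /defect innerBl innerBr; congr (_ - _).
by rewrite adjointP// innerC -adjointP// innerC.
Qed.

(** The square of [|adjoint L u|] is the inner product of [L (adjoint L u)] and [u], hence at most
    [|adjoint L u| * |u|]. *)
Lemma norm_adjoint_le L : bounded_operator L -> opnorm L <= 1 ->
  forall u, `|adjoint L u| <= `|u|.
Proof.
move=> bL L1 u; have [->|z0] := eqVneq (adjoint L u) 0; first by rewrite normr0.
have nz : 0 < `|adjoint L u| by rewrite normr_gt0.
rewrite -(ler_pM2l nz) -expr2 -inner_norm -adjointP//.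
rewrite (le_trans (ler_norm _))// (le_trans (cauchy_schwarz _ _))//.
by rewrite ler_wpM2r// (le_trans (opnorm_le bL _))// ler_piMl.
Qed.

Lemma inner_defect L u : bounded_operator L ->
  inner (defect L u) u = `|u| ^+ 2 - `|adjoint L u| ^+ 2.
Proof. by move=> bL; rewrite innerBl adjointP// !inner_norm. Qed.

Lemma defect_ge0 L u : bounded_operator L -> opnorm L <= 1 ->
  0 <= inner (defect L u) u.
Proof.
move=> bL L1; rewrite inner_defect// subr_ge0 ler_pXn2r ?nnegrE//.
exact: norm_adjoint_le.
Qed.

Lemma defect_le L u : bounded_operator L -> inner (defect L u) u <= inner u u.
Proof. by move=> bL; rewrite inner_defect// inner_norm gerBl sqr_ge0. Qed.

(* The graph relation [y \in (L cocomposed with B) x] unfolds to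
   [y = L^* u] and [L (x + gamma y) = B^-1 u + gamma u], that is, to
   [y = L^* u] and [(B^-1 + gamma (1 - L L^* )) u = L x]. *)
Lemma resolvent_cocompE L B B' W gamma : bounded_operator L ->
  cancel B B' -> cancel B' B ->
  cancel (B' \+ gamma \*: defect L) W -> cancel W (B' \+ gamma \*: defect L) ->
  resolvent_cocomp gamma L (single B) = single (adjoint L \o W \o L).
Proof.
move=> bL BK B'K MK WK; have lL := bL.1.
have Lshift x u : L (x + gamma *: adjoint L u) = L x + gamma *: L (adjoint L u).
  by rewrite (linearPD lL) (linearPZ lL).
(* The inner resolvent composition has parameter [gamma^-1], so its shifts are by [gamma] times the
   identity. *)
rewrite /resolvent_cocomp /resolvent_comp invrK; apply/funext => x.
apply/seteqP; split=> y.
  move=> [p [u [_ /= -> [v /= uv [_ /= -> vuE]] /= yu] [_ /= -> px]]].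
  have {px}pE : p = x + gamma *: y by rewrite -px /= scaleNr subrK.
  rewrite /single /= yu -(MK u); congr (adjoint L (W _)).
  move: vuE; rewrite pE yu Lshift uv /= BK /defect scalerBr addrA => ->.
  by rewrite addrK.
rewrite /single /= => ->; set u := W (L x).
(* With [y = adjoint L u], undoing the outer shift forces the witness [x + gamma *: y]. *)
exists (x + gamma *: adjoint L u); last first.
  exists (- gamma *: adjoint L u); first by rewrite /single.
  by rewrite scaleNr addrK.
exists u => //; exists (L (x + gamma *: adjoint L u)) => //.
exists (B' u); first by rewrite /sv_inv /single /= B'K.
exists (gamma *: u) => //; rewrite Lshift -[in RHS](WK (L x)) -/u.
by rewrite /= /defect scalerBr addrA subrK.
Qed.

End Cocomposition.

(** * Loewner comparisons between cocompositions *)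

Section CocompositionOrder.
Context {R : realType} {H G : hilbertType R}.
Context (L : H -> G) (bL : bounded_operator L) (L1 : opnorm L <= 1).
Implicit Types (A B : G -> G) (gamma rho : R).

(** The defect adds a nonnegative form, so a coercivity constant of [B] survives. *)
Lemma strongly_positive_defect B gamma : strongly_positive_operator B ->
  0 <= gamma -> strongly_positive_operator (B \+ gamma \*: defect L).
Proof.
move=> /strongly_positiveP[/selfadjointP[bB sB] [a a0 aB]] g0.
have /selfadjointP[bD sD] := selfadjoint_defect bL.
apply/strongly_positiveP; split.
  apply/selfadjointP; split; first exact/bounded_operatorD/bounded_operatorZ.
  by move=> x y /=; rewrite innerDl innerDr innerZl innerZr sB sD.
exists a => // x /=; rewrite innerDl innerZl (le_trans (aB x))// lerDl.
by rewrite mulr_ge0// defect_ge0.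
Qed.

Lemma resolvent_cocomp_repr B B' gamma :
  strongly_positive_operator B' -> cancel B B' -> cancel B' B -> 0 <= gamma ->
  exists W, [/\ selfadjoint W, cancel W (B' \+ gamma \*: defect L) &
    resolvent_cocomp gamma L (single B) = single (adjoint L \o W \o L)].
Proof.
move=> sB' BK B'K g0.
have [W [[[sW _] _] MK WK]] :=
  strongly_positive_inverse (strongly_positive_defect sB' g0).
by exists W; split=> //; exact: resolvent_cocompE.
Qed.

Lemma sv_loewner_le_sandwich (V W : G -> G) : selfadjoint V -> selfadjoint W ->
  (forall u, inner (V u) u <= inner (W u) u) ->
  sv_loewner_le (single (adjoint L \o V \o L)) (single (adjoint L \o W \o L)).
Proof.
move=> sV sW VW; exists (adjoint L \o V \o L), (adjoint L \o W \o L).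
by split=> //; apply: loewner_le_sandwich => //; apply/loewner_leP.
Qed.

(** Inversion turns [A <= B] into [B' <= A']; adding [rho] and [gamma] times the defect keeps this
    order, and a second inversion restores the original one. Allowing [rho = 0] also covers the
    upper bound by the plain composition. *)
Lemma resolvent_cocomp_le A B rho gamma : strongly_positive_operator A ->
  strongly_positive_operator B -> loewner_le A B -> 0 <= rho -> rho <= gamma ->
  sv_loewner_le (resolvent_cocomp gamma L (single A))
                (resolvent_cocomp rho L (single B)).
Proof.
move=> sA sB /loewner_leP[_ _ AB] rho0 rho_gamma.
have [A' [sA' AK A'K]] := strongly_positive_inverse sA.
have [B' [sB' BK B'K]] := strongly_positive_inverse sB.
have [V [sV VK ->]] :=
  resolvent_cocomp_repr sA' AK A'K (le_trans rho0 rho_gamma).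
have [W [sW WK ->]] := resolvent_cocomp_repr sB' BK B'K rho0.
apply: sv_loewner_le_sandwich => // u.
apply: (inverse_antitone (strongly_positive_defect sB' rho0).1 WK VK) => {}u.
rewrite /= !innerDl !innerZl lerD//; first exact: (inverse_antitone sA.1).
by rewrite ler_wpM2r// defect_ge0.
Qed.

(* With [gamma = 0], Rocq's convention [0^-1 = 0] makes the cocomposition the
   ordinary composition. *)
Lemma resolvent_cocomp0 B : strongly_positive_operator B ->
  resolvent_cocomp 0 L (single B) = single (adjoint L \o B \o L).
Proof.
move=> sB; have [B' [_ BK B'K]] := strongly_positive_inverse sB.
have M0 : B' \+ 0 \*: defect L = B'.
  by apply/funext => u; rewrite /= scale0r addr0.
by apply: (@resolvent_cocompE _ _ _ _ _ B') => //; rewrite M0.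
Qed.

(** Invert the bound of [B] by [opnorm B] times the identity. *)
Lemma strongly_positive_inverse_ge B B' u : strongly_positive_operator B ->
  cancel B' B -> inner u u <= opnorm B * inner (B' u) u.
Proof.
move=> sB B'K; have bB := sB.1.1.1.
(* A zero norm cannot be divided by; in that case [u = B (B' u)] is zero. *)
have [B0|B0] := eqVneq (opnorm B) 0.
  have := opnorm_le bB (B' u); rewrite B'K B0 mul0r normr_le0 => /eqP ->.
  by rewrite inner0l mul0r.
have {}B0 : 0 < opnorm B by rewrite lt0r B0 opnorm_ge0.
rewrite mulrC -ler_pdivrMr// mulrC -innerZl.
apply: (@inverse_antitone _ _ B (opnorm B \*: idfun) B' (_ \*: idfun) sB.1) => //.
  by move=> v; rewrite /= scalerA divff ?gt_eqF// scale1r.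
move=> v; rewrite /= innerZl inner_norm (le_trans (ler_norm _))//.
rewrite (le_trans (cauchy_schwarz _ _))// expr2 mulrA ler_wpM2r//.
exact: opnorm_le.
Qed.

Lemma resolvent_cocomp_ge B gamma : strongly_positive_operator B ->
  0 <= gamma ->
  sv_loewner_le
    (single ((1 + gamma * opnorm B)^-1 \*: (adjoint L \o B \o L)))
    (resolvent_cocomp gamma L (single B)).
Proof.
move=> sB g0; have [[[bB BB] _] _] := sB; set c := 1 + _.
have c0 : 0 < c by rewrite ltr_wpDr// mulr_ge0// opnorm_ge0.
(* Moving the scalar inside makes both sides sandwiches by [L]. *)
have -> : c^-1 \*: (adjoint L \o B \o L) = adjoint L \o (c^-1 \*: B) \o L.
  apply/funext => x; rewrite /= (linearPZ _ c^-1)//.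
  exact: (bounded_operator_adjoint bL).1.
have [B' [sB' BK B'K]] := strongly_positive_inverse sB.
have [W [sW WK ->]] := resolvent_cocomp_repr sB' BK B'K g0.
have /selfadjointP[_ sBB] := sB.1.1.
apply: sv_loewner_le_sandwich => //.
  apply/selfadjointP; split; first exact: bounded_operatorZ.
  by move=> x y /=; rewrite innerZl innerZr sBB.
(* Since [c^-1 \*: B] inverts [c \*: B'], it remains to bound [B' \+ gamma \*: defect L] by
   [c \*: B']. *)
apply: (inverse_antitone (B := c \*: B') (strongly_positive_defect sB' g0).1 WK).
  move=> u /=; rewrite (linearPZ sB'.1.1.1.1) scalerA divff ?gt_eqF// scale1r.
  exact: BK.
move=> u /=; rewrite innerDl !innerZl mulrDl mul1r lerD2l -mulrA ler_wpM2l//.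
exact: le_trans (defect_le u bL) (strongly_positive_inverse_ge u sB B'K).
Qed.

End CocompositionOrder.

Theorem proposition3p3 (R : realType) (H G : hilbertType R)
    (L : H -> G) (hL : bounded_operator L)
    (hL0 : 0 < opnorm L) (hL1 : opnorm L <= 1)
    (B : G -> G) (hB : strongly_positive_operator B)
    (gamma : R) (hgamma : 0 < gamma) :
  [/\ let theta := 1 / (1 + gamma * opnorm B) in
      sv_loewner_le (single (theta \*: (adjoint L \o B \o L)))
                    (resolvent_cocomp gamma L (single B)) /\
      sv_loewner_le (resolvent_cocomp gamma L (single B))
                    (single (adjoint L \o B \o L)),
      forall A : G -> G, strongly_positive_operator A -> loewner_le A B ->
        sv_loewner_le (resolvent_cocomp gamma L (single A))
                      (resolvent_cocomp gamma L (single B))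
    & forall rho : R, 0 < rho -> rho <= gamma ->
        sv_loewner_le (resolvent_cocomp gamma L (single B))
                      (resolvent_cocomp rho L (single B))].
Proof.
have lexxB : loewner_le B B by apply/loewner_leP; split=> //; exact: hB.1.1.
have gamma0 := ltW hgamma.
split=> [|A sA AB|rho rho0 rho_gamma] /=.
- split; first by rewrite div1r; exact: resolvent_cocomp_ge.
  (* The upper bound is monotonicity in the parameter, taken from [gamma] down to 0. *)
  by rewrite -(resolvent_cocomp0 hL hB); exact: resolvent_cocomp_le.
- exact: resolvent_cocomp_le.
- by apply: resolvent_cocomp_le => //; exact: ltW.
Qed.
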